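(* (1) An increasing function $f:[0,1]\to[0,\infty]$ is a calibrator if and only if $$\int_0^1\frac{dx}{f(x)}\le 1.$$ (2) Any calibrator is dominated by an admissible calibrator. (3) A calibrator $f$ is admissible if and only if it is left-continuous and $$\int_0^1\frac{dx}{f(x)}=1.$$
   Context: Conventions: $1/0=\infty$, $1/\infty=0$; ''increasing'' means not necessarily strictly increasing. Given a probability space $(\Omega,\mathcal{F},\mathbf{P})$: a $p$-test is a measurable function $p:\Omega\to[0,1]$ such that $\mathbf{P}\{\omega: p(\omega)\le\delta\}\le\delta$ for all $\delta\in[0,1]$. A Bayes factor (for $\mathbf{P}$) is a nonnegative measurable function $B:\Omega\to[0,\infty]$ with $\int(1/B)\,d\mathbf{P}\le1$. An increasing function $f:[0,1]\to[0,\infty]$ is called a calibrator if $f(p)$ is a Bayes factor for any $p$-test $p$ (on any probability space). A calibrator $f$ dominates a calibrator $g$ if $f(x)\le g(x)$ for all $x\in[0,1]$ (so ''$g$ is dominated by $f$'' means $f\le g$ pointwise); $f$ strictly dominates $g$ if $f$ dominates $g$ and $f(x)<g(x)$ for some $x\in[0,1]$. A calibrator is admissible if it is not strictly dominated by any other calibrator.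
   Formalization: In (3), ''left-continuous'' is taken to include f(0)=0 (f extended by 0 to the left of 0); without this (3) fails, e.g. for f=1, which is strictly dominated by the calibrator equal to 0 at 0 and 1 on (0,1]. *)

(* Defs.v *)
(* MathComp-Analysis, over an abstract [R : realType]. *)
From HB Require Import structures.
From mathcomp Require Import all_boot all_order all_algebra.
From mathcomp Require Import all_classical all_reals all_analysis.
From mathcomp Require Import measurable_realfun.

Set Implicit Arguments.
Unset Strict Implicit.
Unset Printing Implicit Defensive.

Import Order.TTheory GRing.Theory Num.Theory.
Import numFieldNormedType.Exports.

Local Open Scope classical_set_scope.
Local Open Scope ring_scope.
Local Open Scope ereal_scope.

(* [x^-1] on [\bar R] satisfies 0^-1 = +oo and +oo^-1 = 0. *)

Definition ptest d (T : measurableType d) (R : realType)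
    (P : probability T R) (p : T -> R) : Prop :=
  [/\ measurable_fun setT p,
      (forall w, (0 <= p w <= 1)%R) &
      forall delta : R, (0 <= delta <= 1)%R ->
        P [set w | (p w <= delta)%R] <= delta%:E].

Definition bayes_factor d (T : measurableType d) (R : realType)
    (P : probability T R) (B : T -> \bar R) : Prop :=
  [/\ measurable_fun setT B,
      (forall w, 0 <= B w) &
      \int[P]_w (B w)^-1 <= 1].

(* A function [0,1] -> [0,+oo] is represented by a total [f : R -> \bar R];
   only its values on [0,1] are ever constrained or used. *)
Definition increasing01 (R : realType) (f : R -> \bar R) : Prop :=
  (forall x : R, (0 <= x <= 1)%R -> 0 <= f x) /\
  (forall x y : R, (0 <= x)%R -> (x <= y)%R -> (y <= 1)%R -> f x <= f y).

Definition calibrator (R : realType) (f : R -> \bar R) : Prop :=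
  increasing01 f /\
  forall d (T : measurableType d) (P : probability T R) (p : T -> R),
    ptest P p -> bayes_factor P (f \o p).

Definition dominates (R : realType) (f g : R -> \bar R) : Prop :=
  forall x : R, (0 <= x <= 1)%R -> f x <= g x.

Definition strictly_dominates (R : realType) (f g : R -> \bar R) : Prop :=
  dominates f g /\ exists x : R, (0 <= x <= 1)%R /\ f x < g x.

Definition admissible (R : realType) (f : R -> \bar R) : Prop :=
  calibrator f /\
  forall g : R -> \bar R, calibrator g -> ~ strictly_dominates g f.

(* Left-continuity at every point of [0,1], the endpoint 0 included, of f
   extended by 0 off [0,1] ([f \_ `[0, 1]]); at 0 it says f 0 = 0, see
   [left_continuous01P].  Reading it as void at 0 would let the constant 1
   count as left-continuous with \int 1/f = 1, although it is strictly
   dominated by the calibrator equal to 0 at 0 and to 1 on ]0, 1]. *)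
Definition left_continuous01 (R : realType) (f : R -> \bar R) : Prop :=
  forall x : R, (0 <= x <= 1)%R ->
    (f \_ `[0%R, 1%R]) y @[y --> x^'-] --> f x.

Lemma left_continuous01P (R : realType) (f : R -> \bar R) :
  left_continuous01 f <->
  f 0%R = 0 /\
  forall x : R, (0 < x <= 1)%R -> f y @[y --> x^'-] --> f x.
Proof.
have pos (x : R) : (0 < x <= 1)%R ->
    \forall y \near x^'-, f y = (f \_ `[0%R, 1%R]) y.
  move=> /andP[x0 x1]; near=> y.
  rewrite patchE ifT// inE/= in_itv/=; apply/andP; split.
    by apply: ltW; near: y; exact: nbhs_left_gt.
  by apply: le_trans x1; near: y; exact: nbhs_left_le.
have neg : \forall y \near (0 : R)^'-, (f \_ `[0%R, 1%R]) y = 0.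
  near=> y; rewrite patchE ifF//; apply/negbTE; rewrite notin_setE/= in_itv/=.
  by apply/negP; rewrite negb_and -ltNge; apply/orP; left; near: y;
     exact: nbhs_left_lt.
split=> [lf|[f0 lf] x /andP[]].
  split.
    have /lf h : (0 <= 0 :> R)%R && (0 <= 1 :> R)%R by rewrite lexx ler01.
    have h0 : (f \_ `[0%R, 1%R]) y @[y --> (0 : R)^'-] --> (0 : \bar R).
      exact: cvg_near_cst.
    exact: (cvg_unique _ h h0).
  move=> x x01; have /andP[x0 x1] := x01.
  apply: cvg_trans (lf x _); last by rewrite (ltW x0).
  apply: near_eq_cvg; move: (pos _ x01).
  by apply: filterS => y ->.
rewrite le_eqVlt => /predU1P[<- _|x0 x1].
  by rewrite f0; exact: cvg_near_cst.
have x01 : (0 < x <= 1)%R by rewrite x0.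
by apply: cvg_trans (lf _ x01); apply: near_eq_cvg; exact: pos.
Unshelve. all: by end_near. Qed.

(* Main.v *)
Require Import Defs.
From mathcomp Require Import all_boot all_order all_algebra.
From mathcomp Require Import all_classical all_reals all_analysis.
From mathcomp Require Import measurable_realfun.
Import Order.TTheory GRing.Theory Num.Theory.
Import numFieldNormedType.Exports.
Local Open Scope classical_set_scope.
Local Open Scope ring_scope.
Local Open Scope ereal_scope.

Set Implicit Arguments.
Unset Strict Implicit.
Unset Printing Implicit Defensive.

(** Write I(f) for the integral of 1/f over [[0, 1]].

    Criterion.  The identity of [[0, 1]] is a p-test for the uniform law, so a
    calibrator f satisfies I(f) <= 1 ([integral_le1_of_calibrator]).
    Conversely, 1/f is decreasing, so each level set {1/f > t} is an initial
    segment A of [[0, 1]], with supremum s say; a p-test p then satisfies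
    P(p in A) <= P(p <= s) <= s = |A| ([ptest_initial_segment]).  Integrating
    these tail inequalities over t, by the layer-cake formula ([layer_cake]),
    gives E(1/f(p)) <= I(f) ([calibrator_of_integral_le1]).

    Domination.  A calibrator g can be lowered in two ways.  Its left
    regularisation, the supremum of g over [[0, x[], differs from g at
    countably many points only, so it has the same integral
    ([left_reg_neq_countable], [integral_left_reg]); it is left-continuous and
    vanishes at 0.  Multiplying it by I(g) <= 1 then brings the integral to
    exactly 1.  When I(g) = 0 this factor is useless, but then g is infinite
    on []0, 1]] and lies above the left regularisation of the constant 1
    ([exists_normalized_dominator]).

    Admissibility.  If f is left-continuous with I(f) = 1 and g <= f with
    g x < f x, left-continuity opens a fixed gap between g and f on a whole
    interval ending at x, so I(g) > I(f) = 1 and g is no calibrator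
    ([admissible_of_left_continuous]).  Hence the functions produced in the
    domination step are admissible, and an admissible f, which must coincide
    with the one that lies below it, inherits left-continuity and I(f) = 1. *)

(** * Monotone functions on the unit interval *)


Lemma measurable_fun_interval_levels (R : realType) (D : set R)
    (h : R -> \bar R) :
  (forall y : \bar R, is_interval (D `&` [set x | y < h x])) ->
  measurable_fun D h.
Proof.
move=> Dh.
apply: (measurability _ (ErealGenOInfty.measurableE R)) => _ [_ [r ->] <-].
rewrite (_ : _ `&` _ = D `&` [set x | r%:E < h x]); last first.
  by apply/seteqP; split => x /=; rewrite in_itv/= andbT.
exact: is_interval_measurable.
Qed.

Lemma measurable_increasing01_inv (R : realType) (f : R -> \bar R) :
  increasing01 f -> measurable_fun (`[0%R, 1%R] : set R) (fun x => (f x)^-1).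
Proof.
move=> [f0 fi]; apply: measurable_fun_interval_levels => y.
move=> a b [/=]; rewrite !in_itv/= => /andP[a0 a1] _ [/andP[b0 b1] yb].
move=> c /andP[ac cb].
have c01 : (0 <= c <= 1)%R by rewrite (le_trans a0 ac) (le_trans cb b1).
split; first by rewrite /= in_itv.
apply: (lt_le_trans yb); rewrite lee_pV2 ?inE; last 2 first.
  by apply: f0; rewrite b0 b1.
  exact: f0.
by apply: fi; case/andP: c01.
Qed.

Lemma measurable_increasing01 (R : realType) (f : R -> \bar R) :
  increasing01 f -> measurable_fun (`[0%R, 1%R] : set R) f.
Proof.
move=> [f0 fi]; apply: measurable_fun_interval_levels => y.
move=> a b [/=]; rewrite !in_itv/= => /andP[a0 a1] ya [/andP[b0 b1] _].
move=> c /andP[ac cb].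
have c01 : (0 <= c <= 1)%R by rewrite (le_trans a0 ac) (le_trans cb b1).
split; first by rewrite /= in_itv.
by apply: (lt_le_trans ya); apply: fi => //; case/andP: c01.
Qed.

Lemma increasing01_inv_ge0 (R : realType) (f : R -> \bar R) (x : R) :
  increasing01 f -> `[0%R, 1%R]%classic x -> 0 <= (f x)^-1.
Proof. by move=> [f0 _]; rewrite /= in_itv/= inve_ge0 => /f0. Qed.

(** * Comparing integrals through tails *)

(** Both sides integrate, in the two possible orders, the indicator of the
    subgraph of [h]. *)
Lemma layer_cake d (T : measurableType d) (R : realType)
    (mu : {sigma_finite_measure set T -> \bar R}) (h : T -> \bar R) :
  measurable_fun setT h -> (forall x, 0 <= h x) ->
  \int[mu]_x h x =
  \int[lebesgue_measure]_(t in `[0%R, +oo[) mu [set x | t%:E < h x].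
Proof.
move=> mh h0.
pose D : set R := `[0%R, +oo[%classic.
(* The part of the subgraph of h above the nonnegative half-line. *)
pose A : set (T * measurableTypeR R) := [set z | z.2%:E < h z.1] `&` [set z | D z.2].
have mA : measurable A.
  have m2 : measurable_fun setT (fun z : T * measurableTypeR R => z.2%:E).
    by apply/measurable_EFinP; exact: measurable_snd.
  have m1 : measurable_fun setT (fun z : T * measurableTypeR R => h z.1).
    exact: measurableT_comp.
  apply: measurableI; rewrite -[X in measurable X]setTI.
    exact: (measurable_lte measurableT m2 m1).
  have mD : measurable (D : set (measurableTypeR R)) by exact: measurable_itv.
  have ms : measurable_fun setT (snd : T * measurableTypeR R -> measurableTypeR R).
    exact: measurable_snd.
  exact: (ms measurableT _ mD).
have inA x (t : R) : ((x, t) \in A) = (t \in D `&` [set s : R | s%:E < h x]).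
  by apply/idP/idP; rewrite !inE => -[].
have slice x : \int[lebesgue_measure]_t (\1_A (x, t))%:E = h x.
  rewrite (_ : (fun _ => _) =
      fun t : R => (\1_(D `&` [set s : R | (s%:E < h x)%E]) t)%:E).
    rewrite integral_indic//; last first.
      apply: is_interval_measurable => a b [].
      rewrite /D/= !in_itv/= !andbT => a0 _ [_ bh] c /andP[ac cb].
      rewrite in_itv/= andbT (le_trans a0 ac); split=> //.
      by apply: le_lt_trans bh; rewrite lee_fin.
    rewrite setIT; have := h0 x; case: (h x) => [r|_|//].
    - rewrite lee_fin => r0.
      rewrite (_ : _ `&` _ = ([set` `[0%R, r[] : set R)); last first.
        apply/seteqP; split => t; rewrite /D/= !in_itv/= andbT lte_fin.
          by move=> [-> ->].
        by move=> /andP[-> ->].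
      rewrite /= lebesgue_measure_itv/= lte_fin sube0.
      by case: ltP => // r0'; apply/eqP; rewrite eqe eq_le r0 r0'.
    - rewrite (_ : _ `&` _ = ([set` `[0%R, +oo[] : set R)); last first.
        by apply/seteqP; split => t /= => [[]//|Dt]; split => //; rewrite ltry.
      by rewrite /= lebesgue_measure_itv/= ltry.
  by apply/funext => t; rewrite !indicE inA.
under eq_integral do rewrite -slice.
rewrite (fubini_tonelli (fun z => (\1_A z)%:E)); last 2 first.
  by apply/measurable_EFinP; exact: measurable_indic.
  by move=> z; rewrite lee_fin.
rewrite [RHS]integral_mkcond/=; apply: eq_integral => t _.
rewrite patchE; case: ifPn => tD.
  rewrite -[in RHS](setIT [set x | _]) -integral_indic//.
    apply: eq_integral => x _; rewrite !indicE inA in_setI tD/=.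
    suff -> : (t \in [set s : R | s%:E < h x]) = (x \in [set y | t%:E < h y]) by [].
    by apply/idP/idP; rewrite !inE.
  rewrite -[X in measurable X]setTI.
  by apply: measurable_lte => //; exact: measurable_cst.
rewrite integral0_eq// => x _; rewrite indicE memNset//.
by case=> _; apply/negP; move: tD; rewrite notin_setE => /negP.
Qed.

Lemma measurable_gt_level d (T : measurableType d) (R : realType)
    (h : T -> \bar R) (t : R) :
  measurable_fun setT h -> measurable [set x | t%:E < h x].
Proof.
move=> mh; rewrite -[X in measurable X]setTI.
by apply: measurable_lte => //; exact: measurable_cst.
Qed.

(** The tail of [h] is decreasing in [t], so its level sets are intervals. *)
Lemma measurable_tail d (T : measurableType d) (R : realType)
    (mu : {measure set T -> \bar R}) (h : T -> \bar R) :
  measurable_fun setT h ->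
  measurable_fun (`[0%R, +oo[ : set R) (fun t => mu [set x | t%:E < h x]).
Proof.
move=> mh; apply: measurable_fun_interval_levels => y a b [/=].
rewrite !in_itv/= !andbT => a0 _ [_ yb] c /andP[ac cb].
split; first by rewrite /= in_itv/= andbT (le_trans a0 ac).
apply: (lt_le_trans yb); apply: le_measure; rewrite ?inE.
- exact: measurable_gt_level.
- exact: measurable_gt_level.
- by move=> x /=; apply: le_lt_trans; rewrite lee_fin.
Qed.

Lemma le_integral_tails d1 d2 (T1 : measurableType d1) (T2 : measurableType d2)
    (R : realType) (mu : {sigma_finite_measure set T1 -> \bar R})
    (nu : {sigma_finite_measure set T2 -> \bar R})
    (h : T1 -> \bar R) (k : T2 -> \bar R) :
  measurable_fun setT h -> (forall x, 0 <= h x) ->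
  measurable_fun setT k -> (forall x, 0 <= k x) ->
  (forall t : R, (0 <= t)%R ->
    mu [set x | t%:E < h x] <= nu [set x | t%:E < k x]) ->
  \int[mu]_x h x <= \int[nu]_x k x.
Proof.
move=> mh h0 mk k0 hk; rewrite !layer_cake//.
apply: ge0_le_integral => //.
- exact: measurable_tail.
- exact: measurable_tail.
- by move=> t; rewrite /= in_itv/= andbT; exact: hk.
Qed.

(** * The integral criterion *)

(** Whether or not [A] contains its supremum [s], the event [p \in A] is
    contained in [p <= s], while [A] contains [[0, s[], of length [s]: the
    definition of a p-test applies at the single level [s]. *)
Lemma ptest_initial_segment d (T : measurableType d) (R : realType)
    (P : probability T R) (p : T -> R) (A : set R) :
  ptest P p -> measurable A -> A `<=` `[0%R, 1%R] ->
  (forall x y, (0 <= x)%R -> (x <= y)%R -> A y -> A x) ->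
  P (p @^-1` A) <= lebesgue_measure A.
Proof.
move=> [mp p01 pt] mA A01 down.
have [->|/set0P[a Aa]] := eqVneq A set0.
  by rewrite preimage_set0 measure0.
have Aub : has_ubound A by exists 1%R => x /A01/=; rewrite in_itv => /andP[].
have s0 : (0 <= sup A)%R.
  have /A01/= := Aa; rewrite in_itv/= => /andP[a0 _].
  by apply: (le_trans a0); exact: ub_le_sup.
have s1 : (sup A <= 1)%R.
  by apply: ge_sup => [|x /A01/=]; [exists a|rewrite in_itv => /andP[]].
have As : `[0%R, sup A[ `<=` A.
  move=> x /=; rewrite in_itv/= => /andP[x0 xs].
  have [y Ay xy] := sup_gt (ex_intro _ a Aa) xs.
  by apply: down Ay => //; exact: ltW.
apply: (@le_trans _ _ (P [set w | (p w <= sup A)%R])).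
  apply: le_measure; rewrite ?inE.
  - by rewrite -[X in measurable X]setTI; exact: mp.
  - rewrite (_ : [set w | _] = p @^-1` `]-oo, sup A]%classic); last first.
      by apply/seteqP; split => w /=; rewrite in_itv.
    by rewrite -[X in measurable X]setTI; exact: mp.
  - by move=> w /= Aw; exact: ub_le_sup.
apply: (@le_trans _ _ (sup A)%:E); first by apply: pt; rewrite s0 s1.
apply: (@le_trans _ _ (lebesgue_measure (`[0%R, sup A[%classic : set R))).
  rewrite lebesgue_measure_itv/= lte_fin sube0; case: ifPn => //.
  by rewrite -leNgt lee_fin.
by apply: le_measure; rewrite ?inE.
Qed.

Lemma calibrator_of_integral_le1 (R : realType) (f : R -> \bar R) :
  increasing01 f ->
  \int[lebesgue_measure]_(x in `[0%R, 1%R]) (f x)^-1 <= 1 -> calibrator f.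
Proof.
move=> fi f1; split => // d T P p pp; have [mp p01 _] := pp.
have pI : p @` setT `<=` `[0%R, 1%R].
  by move=> _ [w _ <-] /=; rewrite in_itv; exact: p01.
have mitv : measurable (`[0%R, 1%R]%classic : set R) by [].
have mfV := measurable_increasing01_inv fi.
split.
- exact: measurable_comp mitv pI (measurable_increasing01 fi) mp.
- by move=> w; apply: fi.1; exact: p01.
apply: le_trans f1; rewrite [leRHS]integral_mkcond/=.
apply: le_integral_tails.
- exact: (measurable_comp mitv pI mfV mp).
- by move=> w; rewrite inve_ge0; apply: fi.1; exact: p01.
- exact/(measurable_restrictT _ _).1.
- by move=> x; rewrite patchE; case: ifPn => // /set_mem; exact: increasing01_inv_ge0.
move=> t t0.
(* Both tails are those of the same initial segment A of the unit interval. *)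
pose A : set R := `[0%R, 1%R] `&` [set x | t%:E < (f x)^-1].
rewrite (_ : [set w | _] = p @^-1` A); last first.
  apply/seteqP; split => w /= => [wt|[]//]; split => //.
  by rewrite /= in_itv; exact: p01.
have -> : [set x | t%:E < ((fun x => (f x)^-1) \_ `[0%R, 1%R]) x] = A.
  apply/seteqP; split => x /=.
    rewrite patchE; case: ifPn => [/set_mem//|_].
    by rewrite lte_fin ltNge t0.
  by move=> [x01 tx]; rewrite patchE ifT// inE.
apply: ptest_initial_segment => //.
- by apply: measurable_lte => //; exact: measurable_cst.
- by move=> x [].
- move=> x y x0 xy [/=]; rewrite in_itv/= => /andP[y0 y1] ty.
  have x01 : (0 <= x <= 1)%R by rewrite x0 (le_trans xy).
  split; first by rewrite /= in_itv.
  apply: (lt_le_trans ty); rewrite lee_pV2 ?inE; last 2 first.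
    by apply: fi.1; rewrite y0 y1.
    exact: fi.1.
  exact: fi.2.
Qed.

(** A p-test takes its values in [[0, 1]] everywhere, not only almost surely,
    so the identity of the line has to be truncated. *)
Definition clamp01 {R : realType} (x : measurableTypeR R) : R :=
  Num.max 0%R (Num.min x 1%R).

Lemma clamp01_ge0_le1 (R : realType) (x : R) : (0 <= clamp01 x <= 1)%R.
Proof. by rewrite /clamp01 le_max lexx ge_max ler01 ge_min lexx orbT. Qed.

Lemma clamp01_id (R : realType) (x : R) : (0 <= x <= 1)%R -> clamp01 x = x.
Proof. by move=> /andP[x0 x1]; rewrite /clamp01 min_l// max_r. Qed.

Lemma measurable_clamp01 (R : realType) : measurable_fun setT (@clamp01 R).
Proof.
apply: measurable_maxr; first exact: measurable_cst.
by apply: measurable_minr; [exact: measurable_id|exact: measurable_cst].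
Qed.

Lemma ptest_clamp01 (R : realType) :
  ptest (uniform_prob (@ltr01 R)) (@clamp01 R).
Proof.
split; first exact: measurable_clamp01.
  exact: clamp01_ge0_le1.
move=> t /andP[t0 t1].
set E : set (measurableTypeR R) := [set x | _].
have mE : measurable E.
  rewrite (_ : E = clamp01 @^-1` `]-oo, t]%classic); last first.
    by apply/seteqP; split => w /=; rewrite in_itv.
  by rewrite -[X in measurable X]setTI; exact: measurable_clamp01.
have := integral_indic (uniform_prob (@ltr01 R)) measurableT mE.
rewrite setIT => <-; rewrite integral_uniform//; last first.
  by apply/measurable_EFinP; exact: measurable_indic.
rewrite subr0 invr1 mul1e integral_indic//.
rewrite (_ : _ `&` _ = ([set` `[0%R, t]] : set R)); last first.
  apply/seteqP; split => x; rewrite /E /= !in_itv/=.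
    by move=> [+ x01]; rewrite clamp01_id// => ->; case/andP: x01 => ->.
  move=> /andP[x0 xt].
  have x01 : (0 <= x <= 1)%R by rewrite x0 (le_trans xt).
  by rewrite clamp01_id.
by rewrite /= lebesgue_measure_itv/= lte_fin sube0; case: ifPn.
Qed.

Lemma integral_le1_of_calibrator (R : realType) (f : R -> \bar R) :
  calibrator f ->
  \int[lebesgue_measure]_(x in `[0%R, 1%R]) (f x)^-1 <= 1.
Proof.
move=> [fi /(_ _ _ _ _ (ptest_clamp01 R))[_ _]].
rewrite integral_uniform//; first last.
- by move=> x; rewrite inve_ge0; apply: fi.1; exact: clamp01_ge0_le1.
- apply: (measurable_comp _ _ (measurable_increasing01_inv fi)
    (@measurable_clamp01 R)) => //.
  by move=> _ [x _ <-]; rewrite /= in_itv; exact: clamp01_ge0_le1.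
rewrite subr0 invr1 mul1e; apply: le_trans; rewrite le_eqVlt; apply/orP; left.
apply/eqP; apply: eq_integral => x /set_mem; rewrite /= in_itv/= => x01.
by rewrite clamp01_id.
Qed.

(** * Left regularisation *)

Lemma ereal_real_between {R : realType} (a b : \bar R) : 0 <= a -> a < b ->
  exists r : R, a < r%:E < b.
Proof.
case: a => [a| |]; [|by move=> _; rewrite ltNge leey|by []].
case: b => [b| |]; [| |by move=> _; rewrite ltNge leNye].
  rewrite lee_fin lte_fin => a0 ab; exists ((a + b) / 2)%R.
  by rewrite !lte_fin !midf_lt.
by move=> _ _; exists (a + 1)%R; rewrite lte_fin ltrDl ltr01 ltry.
Qed.

(** The added value 0 accounts for [x = 0], where the supremum would otherwise
    be that of the empty set, [-oo]. *)
Definition left_reg {R : realType} (f : R -> \bar R) (x : R) : \bar R :=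
  ereal_sup (0 |` f @` `[0%R, x[).

Lemma left_reg_ge {R : realType} (f : R -> \bar R) (x y : R) :
  (0 <= y)%R -> (y < x)%R -> f y <= left_reg f x.
Proof.
move=> y0 yx; apply: ereal_sup_ubound; right; exists y => //=.
by rewrite in_itv/= y0 yx.
Qed.

Lemma left_reg_ge0 {R : realType} (f : R -> \bar R) (x : R) : 0 <= left_reg f x.
Proof. by apply: ereal_sup_ubound; left. Qed.

Lemma left_reg0 {R : realType} (f : R -> \bar R) : left_reg f 0 = 0.
Proof.
apply/le_anti; rewrite left_reg_ge0 andbT;
apply: ge_ereal_sup => _ [->|[y + <-]]; first exact: lexx.
by rewrite /= in_itv/= leNgt andNb.
Qed.

Lemma left_reg_homo {R : realType} (f : R -> \bar R) :
  {homo left_reg f : x y / (x <= y)%R >-> x <= y}.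
Proof.
move=> x y xy; apply: ge_ereal_sup => _ [->|[z + <-]].
  exact: left_reg_ge0.
rewrite /= in_itv/= => /andP[z0 zx]; apply: left_reg_ge => //.
exact: lt_le_trans xy.
Qed.

Lemma left_reg_increasing01 {R : realType} (f : R -> \bar R) :
  increasing01 (left_reg f).
Proof. by split=> [x _|x y _ xy _]; [exact: left_reg_ge0|exact: left_reg_homo]. Qed.

Lemma left_reg_le {R : realType} (f : R -> \bar R) (x : R) :
  increasing01 f -> (0 <= x <= 1)%R -> left_reg f x <= f x.
Proof.
move=> fi x01; apply: ge_ereal_sup => _ [->|[z + <-]]; first exact: fi.1.
rewrite /= in_itv/= => /andP[z0 zx]; apply: fi.2 => //; first exact: ltW.
by case/andP: x01.
Qed.

(** By monotonicity the left limit at [x] is the supremum of [left_reg f] over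
    []0, x[]; a point strictly between [z] and [x] shows that it is at least
    [f z] for each [z < x]. *)
Lemma left_reg_cvg {R : realType} (f : R -> \bar R) (x : R) : (0 < x)%R ->
  left_reg f y @[y --> x^'-] --> left_reg f x.
Proof.
move=> x0; apply/cvg_at_leftNP.
have -> : left_reg f x =
    ereal_sup [set (left_reg f \o -%R) y | y in `](- x)%R, 0%R[].
  apply/le_anti/andP; split; apply: ge_ereal_sup.
    move=> _ [->|[z + <-]].
      apply: (@le_trans _ _ (left_reg f (x / 2)%R)).
        exact: left_reg_ge0.
      apply: ereal_sup_ubound; exists (- (x / 2))%R; last by rewrite /= opprK.
      rewrite /= in_itv/= ltrN2 oppr_lt0 divr_gt0// andbT.
      by rewrite ltr_pdivrMr// ltr_pMr// ltr1n.
    rewrite /= in_itv/= => /andP[z0 zx].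
    have [zm mx] := midf_lt zx.
    apply: (@le_trans _ _ (left_reg f ((z + x) / 2)%R)).
      exact: left_reg_ge.
    apply: ereal_sup_ubound; exists (- ((z + x) / 2))%R; last by rewrite /= opprK.
    by rewrite /= in_itv/= ltrN2 oppr_lt0 mx/= (le_lt_trans z0).
  move=> _ [y + <-]; rewrite /= in_itv => /andP[xy _].
  by apply: left_reg_homo; rewrite lerNl ltW.
apply: (nonincreasing_at_right_cvge (BLeft 0%R)).
  by rewrite bnd_simp oppr_lt0.
by move=> y z _ _ yz /=; apply: left_reg_homo; rewrite lerN2.
Qed.

(** A point where the two functions differ has a rational [q] with
    [left_reg f x < q < f x], and each [q] serves at most one point: for
    [u < v] served by [q], [f u <= left_reg f v] contradicts
    [left_reg f v < q < f u]. *)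
Lemma left_reg_neq_countable {R : realType} (f : R -> \bar R) :
  increasing01 f ->
  countable [set x | (0 <= x <= 1)%R /\ left_reg f x <> f x].
Proof.
move=> fi.
pose S (q : rat) : set R :=
  [set x | (0 <= x <= 1)%R /\ left_reg f x < (ratr q)%:E < f x].
apply: (@sub_countable _ _ _ (\bigcup_q S q)); last first.
  apply: bigcup_countable => [|q _]; first exact: countableP.
  have [->|/set0P[x Sx]] := eqVneq (S q) set0; first exact: countable0.
  apply: (@sub_countable _ _ _ [set x]); last exact: finite_set_countable.
  apply: subset_card_le => y Sy.
  have ordered u v : S q u -> S q v -> ~ (u < v)%R.
    move=> [/andP[u0 _] /andP[_ qu]] [_ /andP[vq _]] uv.
    have := lt_trans vq qu; apply/negP; rewrite -leNgt.
    exact: left_reg_ge.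
  have [yx|xy|//] := ltgtP y x; exfalso; [exact: (ordered y x)|exact: (ordered x y)].
apply: subset_card_le => x [x01 neq].
have lt : left_reg f x < f x by rewrite lt_neqAle left_reg_le// andbT; exact/eqP.
have [r /andP[lr rf]] := ereal_real_between (left_reg_ge0 f x) lt.
have [s /andP[ls sr]] := ereal_real_between (left_reg_ge0 f x) lr.
rewrite lte_fin in sr.
have [q] := rat_in_itvoo sr; rewrite in_itv/= => /andP[sq qr].
exists q => //; split => //.
by rewrite (lt_trans ls) ?lte_fin// (lt_trans _ rf) ?lte_fin.
Qed.

Lemma integral_left_reg {R : realType} (f : R -> \bar R) : increasing01 f ->
  \int[lebesgue_measure]_(x in `[0%R, 1%R]) (left_reg f x)^-1 =
  \int[lebesgue_measure]_(x in `[0%R, 1%R]) (f x)^-1.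
Proof.
move=> fi; have li := left_reg_increasing01 f.
apply: ge0_ae_eq_integral => //.
- exact: measurable_increasing01_inv.
- exact: measurable_increasing01_inv.
- by move=> x; exact: increasing01_inv_ge0.
- by move=> x; exact: increasing01_inv_ge0.
have cN := left_reg_neq_countable fi.
exists [set x | (0 <= x <= 1)%R /\ left_reg f x <> f x]; split.
- exact: countable_measurable.
- exact: countable_lebesgue_measure0.
- move=> x /not_implyP[/=]; rewrite in_itv/= => x01 neq; split => //.
  by move=> e; apply: neq; rewrite e.
Qed.

(** * Domination and admissibility *)

(** A finite value at [x] bounds [1/g] below by a positive constant on
    [[0, x]]. *)
Lemma integral_eq0_pinfty {R : realType} (g : R -> \bar R) (x : R) :
  increasing01 g ->
  \int[lebesgue_measure]_(x in `[0%R, 1%R]) (g x)^-1 = 0 ->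
  (0 < x <= 1)%R -> g x = +oo.
Proof.
move=> gi I0 /andP[x0 x1]; apply/eqP/contraT => gx.
have x01 : (0 <= x <= 1)%R by rewrite ltW.
have sub : `[0%R, x] `<=` (`[0%R, 1%R] : set R).
  by move=> y /=; rewrite !in_itv/= => /andP[-> yx]; rewrite (le_trans yx).
have gx0 : 0 < (g x)^-1.
  by rewrite lt_neqAle inve_ge0 gi.1// andbT eq_sym inve_eq0.
suff : 0 < \int[lebesgue_measure]_(x in `[0%R, 1%R]) (g x)^-1.
  by rewrite I0 ltxx.
apply: (@lt_le_trans _ _
    (\int[lebesgue_measure]_(y in (`[0%R, x] : set R)) cst (g x)^-1 y)).
  rewrite integral_cst//= lebesgue_measure_itv/= lte_fin x0 sube0.
  by rewrite mule_gt0// lte_fin.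
apply: (@le_trans _ _
    (\int[lebesgue_measure]_(y in (`[0%R, x] : set R)) (g y)^-1)).
  apply: ge0_le_integral => //.
  - by move=> y _; exact: ltW.
  - apply: measurable_funS sub _ => //; exact: measurable_increasing01_inv.
  - move=> y /[dup] /sub /=; rewrite !in_itv/= => y01 /andP[_ yx].
    rewrite lee_pV2 ?inE; [|exact: gi.1|exact: gi.1].
    by apply: gi.2 => //; case/andP: y01.
apply: ge0_subset_integral => //; first exact: measurable_increasing01_inv.
by move=> y; exact: increasing01_inv_ge0.
Qed.

(** The witness is [left_reg g] multiplied by the integral [i] of [1/g]: the
    bound [i <= 1] keeps it below [g], and [0 < i] makes the integral of its
    inverse equal to [i^-1 * i]. *)
Lemma normalized_left_reg {R : realType} (g : R -> \bar R) :
  increasing01 g ->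
  0 < \int[lebesgue_measure]_(x in `[0%R, 1%R]) (g x)^-1 <= 1 ->
  exists f : R -> \bar R, [/\ increasing01 f, left_continuous01 f,
    \int[lebesgue_measure]_(x in `[0%R, 1%R]) (f x)^-1 = 1 & dominates f g].
Proof.
move=> gi /andP[I0 I1].
have [i Ei] : exists i : R,
    \int[lebesgue_measure]_(x in `[0%R, 1%R]) (g x)^-1 = i%:E.
  exists (fine (\int[lebesgue_measure]_(x in `[0%R, 1%R]) (g x)^-1)).
  rewrite fineK// ge0_fin_numE ?(ltW I0)//.
  by apply: le_lt_trans I1 _; rewrite ltry.
rewrite Ei lte_fin lee_fin in I0 I1.
have li := left_reg_increasing01 g.
exists (fun x => i%:E * left_reg g x); split.
- split=> [x x01|x y _ xy _].
    by rewrite mule_ge0 ?lee_fin ?(ltW I0)//; exact: left_reg_ge0.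
  by rewrite lee_pmul2l//; exact: left_reg_homo.
- apply/left_continuous01P; split=> [|x /andP[x0 _]].
    by rewrite left_reg0 mule0.
  by apply: cvgeZl => //; exact: left_reg_cvg.
- under eq_integral => x _.
    rewrite inveM; last first.
      by rewrite /inveM_def; case: (left_reg g x) => [s||]//=;
         rewrite gt_eqF//= (ltW I0) implybT.
    over.
  rewrite ge0_integralZl//.
  + rewrite integral_left_reg// Ei inver gt_eqF// -EFinM mulVf// gt_eqF//.
  + exact: measurable_increasing01_inv.
  + by move=> x; exact: increasing01_inv_ge0.
  + by rewrite inve_ge0 lee_fin ltW.
- move=> x x01; apply: (@le_trans _ _ (left_reg g x)); last exact: left_reg_le.
  by rewrite -[leRHS]mul1e lee_wpmul2r ?lee_fin//; exact: left_reg_ge0.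
Qed.

(** When the integral of [1/g] vanishes, the constant 1 is normalised instead
    of [g]. *)
Lemma exists_normalized_dominator {R : realType} (g : R -> \bar R) :
  increasing01 g ->
  \int[lebesgue_measure]_(x in `[0%R, 1%R]) (g x)^-1 <= 1 ->
  exists f : R -> \bar R, [/\ increasing01 f, left_continuous01 f,
    \int[lebesgue_measure]_(x in `[0%R, 1%R]) (f x)^-1 = 1 & dominates f g].
Proof.
move=> gi I1.
have : 0 <= \int[lebesgue_measure]_(x in `[0%R, 1%R]) (g x)^-1.
  by apply: integral_ge0 => x; exact: increasing01_inv_ge0.
rewrite le_eqVlt => /predU1P[/esym I0|I0]; last first.
  by apply: normalized_left_reg; rewrite // I0.
have ci : increasing01 (fun=> 1 : \bar R) by split.
have c1 : \int[lebesgue_measure]_(x in (`[0%R, 1%R] : set R)) (1 : \bar R)^-1 = 1.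
  rewrite inve1 integral_cst// mul1e.
  by rewrite /= lebesgue_measure_itv/= lte_fin ltr01 sube0.
have [|f [fi fl f1 fd]] := normalized_left_reg ci.
  by rewrite c1 lexx lte01.
exists f; split => // x /andP[]; rewrite le_eqVlt => /predU1P[<- _|x0 x1].
  have [-> _] := (left_continuous01P f).1 fl.
  by apply: gi.1; rewrite lexx ler01.
by rewrite (integral_eq0_pinfty gi I0) ?leey// x0.
Qed.

(** Choose reals with [g x < r < s < f x].  Left-continuity and monotonicity
    give [f > s] and [g < r] on a whole interval [[y, x]], which makes the
    integral of [1/g] exceed that of [1/f] by at least
    [(r^-1 - s^-1) * (x - y)]. *)
Lemma admissible_of_left_continuous {R : realType} (f : R -> \bar R) :
  calibrator f -> left_continuous01 f ->
  \int[lebesgue_measure]_(x in `[0%R, 1%R]) (f x)^-1 = 1 ->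
  admissible f.
Proof.
move=> fc /left_continuous01P[f0 fl] f1; split => // g gc [gf [x [x01 gfx]]].
have fi := fc.1; have gi := gc.1; have /andP[x0 x1] := x01.
have xgt0 : (0 < x)%R.
  rewrite lt_neqAle x0 andbT; apply/eqP => xE; move: gfx.
  by rewrite -xE f0 ltNge gi.1// lexx ler01.
have [s /andP[gs sf]] := ereal_real_between (gi.1 _ x01) gfx.
have [r /andP[gr rs]] := ereal_real_between (gi.1 _ x01) gs.
rewrite lte_fin in rs.
have rgt0 : (0 < r)%R by rewrite -lte_fin (le_lt_trans (gi.1 _ x01)).
have sgt0 := lt_trans rgt0 rs.
have xin : (0 < x <= 1)%R by rewrite xgt0.
have nsf : \forall y \near x^'-, s%:E < f y.
  exact: (fl _ xin [set u | s%:E < u] (open_ereal_gt' sf)).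
have [y [y0 yx sy]] : exists y, [/\ (0 < y)%R, (y < x)%R & s%:E < f y].
  near x^'- => y; exists y; split.
  - by near: y; exact: nbhs_left_gt.
  - by near: y; exact: nbhs_left_lt.
  - by near: y; exact: nsf.
pose J : set R := `[y, x]%classic.
pose c : R := (r^-1 - s^-1)%R.
have c0 : (0 < c)%R by rewrite subr_gt0 ltf_pV2// posrE.
have JI : J `<=` `[0%R, 1%R].
  move=> z; rewrite /J/= !in_itv/= => /andP[yz zx].
  by rewrite (le_trans (ltW y0) yz) (le_trans zx x1).
have mJ : measurable_fun (`[0%R, 1%R] : set R) (fun z => (c * \1_J z)%:E).
  apply/measurable_EFinP; apply: measurable_funM; first exact: measurable_cst.
  by apply: measurable_indic; exact: measurable_itv.
have : 1 < \int[lebesgue_measure]_(z in `[0%R, 1%R]) (g z)^-1.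
  apply: (@lt_le_trans _ _ (\int[lebesgue_measure]_(z in `[0%R, 1%R])
      ((f z)^-1 + (c * \1_J z)%:E))).
    rewrite ge0_integralD//; first last.
    - by move=> z _; rewrite lee_fin mulr_ge0// ltW.
    - exact: measurable_increasing01_inv.
    - by move=> z; exact: increasing01_inv_ge0.
    rewrite f1 lteDl//.
    under eq_integral do rewrite EFinM.
    rewrite ge0_integralZl//; first last.
    - by rewrite lee_fin ltW.
    - apply/measurable_EFinP; apply: measurable_indic; exact: measurable_itv.
    rewrite integral_indic//; last exact: measurable_itv.
    rewrite setIidl//= lebesgue_measure_itv/= lte_fin yx -EFinB -EFinM lte_fin.
    by rewrite mulr_gt0// subr_gt0.
  apply: ge0_le_integral => //.
  - move=> z z01; rewrite adde_ge0//; first exact: increasing01_inv_ge0.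
    by rewrite lee_fin mulr_ge0// ltW.
  - by apply: emeasurable_funD => //; exact: measurable_increasing01_inv.
  - exact: measurable_increasing01_inv.
  - move=> z /[dup] zI; rewrite /= in_itv/= => z01.
    have [zJ|zJ] := boolP (z \in J); last first.
      rewrite indicE (negbTE zJ) mulr0 adde0 lee_pV2 ?inE; first exact: gf.
        exact: fi.1.
      exact: gi.1.
    have /andP[yz zx] : (y <= z <= x)%R by move/set_mem: zJ; rewrite /J/= in_itv.
    apply: (@le_trans _ _ (s^-1%:E + (c * \1_J z)%:E)).
      rewrite leeD2r//; have := @inver R s; rewrite gt_eqF// => <-.
      rewrite lee_pV2 ?inE ?lee_fin ?(ltW sgt0)//; last exact: fi.1.
      by rewrite ltW// (lt_le_trans sy)// fi.2// ?(ltW y0)// (le_trans zx).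
    rewrite indicE zJ mulr1 -EFinD addrC subrK.
    have := @inver R r; rewrite gt_eqF// => <-.
    rewrite lee_pV2 ?inE ?lee_fin ?(ltW rgt0)//; last exact: gi.1.
    by rewrite ltW// (le_lt_trans _ gr)// gi.2// (le_trans _ yz)// ltW.
by rewrite ltNge integral_le1_of_calibrator.
Unshelve. all: by end_near. Qed.

Theorem theorem3 (R : realType) :
  (forall f : R -> \bar R, increasing01 f ->
     (calibrator f <->
      \int[lebesgue_measure]_(x in `[0%R, 1%R]) (f x)^-1 <= 1)) /\
  (forall g : R -> \bar R, calibrator g ->
     exists f : R -> \bar R, admissible f /\ dominates f g) /\
  (forall f : R -> \bar R, calibrator f ->
     (admissible f <->
      left_continuous01 f /\
      \int[lebesgue_measure]_(x in `[0%R, 1%R]) (f x)^-1 = 1)).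
Proof.
have dom (g : R -> \bar R) : calibrator g ->
    exists f : R -> \bar R, [/\ calibrator f, left_continuous01 f,
      \int[lebesgue_measure]_(x in `[0%R, 1%R]) (f x)^-1 = 1 & dominates f g].
  move=> gc; have g1 := integral_le1_of_calibrator gc.
  have [f [fi fl f1 fg]] := exists_normalized_dominator gc.1 g1.
  exists f; split => //; apply: calibrator_of_integral_le1 => //.
  by rewrite f1.
split; [|split] => [f fi|g /dom[f [fc fl f1 fg]]|f fc].
- split; [exact: integral_le1_of_calibrator|exact: calibrator_of_integral_le1].
- by exists f; split => //; exact: admissible_of_left_continuous.
- split=> [[_ adm]|[fl f1]]; last exact: admissible_of_left_continuous.
  have [h [hc hl h1 hf]] := dom f fc.
  (* By admissibility, f is its own normalised dominator. *)
  have hE x : (0 <= x <= 1)%R -> h x = f x.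
    move=> x01; apply/eqP; rewrite eq_le hf//= leNgt; apply/negP => hfx.
    by apply: (adm h hc); split => //; exists x.
  split; last first.
    rewrite -h1; apply: eq_integral => x /set_mem.
    by rewrite /= in_itv/= => /hE ->.
  have fhE : f \_ `[0%R, 1%R] = h \_ `[0%R, 1%R].
    apply/funext => x; rewrite !patchE; case: ifPn => // /set_mem.
    by rewrite /= in_itv/= => /hE ->.
  by move=> x x01; rewrite fhE -hE//; exact: hl.
Qed.
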